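(* Consider pairs $(A,\varepsilon)$ consisting of a unital associative $*$-algebra $A$ over $\mathbb{C}$ and a character $\varepsilon\colon A\to\mathbb{C}$, and the properties (LK), (GC), (NC), (AC), (H$^2$Z) of such pairs defined in the context. None of the following implications holds for all such pairs, i.e., for each of them there exists a pair $(A,\varepsilon)$ that satisfies the left-hand side but not the right-hand side: \begin{enumerate} \item (AC) $\Rightarrow$ (H$^2$Z); \item (NC) $\Rightarrow$ (AC); \item (GC) $\Rightarrow$ (AC); \item (GC) $\Rightarrow$ (NC); \item (NC) $\Rightarrow$ (GC); \item (LK) $\Rightarrow$ ((GC) or (NC)). \end{enumerate}
   Context: $A$ is a unital associative $*$-algebra over $\mathbb{C}$; a character is a non-zero $*$-homomorphism $\varepsilon\colon A\to\mathbb{C}$. A pre-Hilbert space is a complex vector space $D$ with a positive definite inner product, linear in the second argument; $L(D)$ is the $*$-algebra of adjointable linear operators $D\to D$. A generating functional on $(A,\varepsilon)$ is a linear $\psi\colon A\to\mathbb{C}$ with $\psi(1)=0$, $\psi(a^* )=\overline{\psi(a)}$ for all $a\in A$, and $\psi(a^*a)\ge0$ for all $a\in\ker\varepsilon$. For a unital $*$-representation $\pi\colon A\to L(D)$, a $\pi$-$\varepsilon$-cocycle is a linear map $\eta\colon A\to D$ with $\eta(ab)=\pi(a)\eta(b)+\eta(a)\varepsilon(b)$ for all $a,b\in A$. A Schürmann triple $(\pi,\eta,\psi)$ over $D$ consists of a unital $*$-representation $\pi\colon A\to L(D)$, a $\pi$-$\varepsilon$-cocycle $\eta\colon A\to D$,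 and a hermitian linear functional $\psi\colon A\to\mathbb{C}$ with $\varepsilon(a)\psi(b)-\psi(ab)+\psi(a)\varepsilon(b)=-\langle\eta(a^* ),\eta(b)\rangle$ for all $a,b\in A$ (then $\psi$ is a generating functional). Every generating functional $\psi$ is part of a Schürmann triple with $\eta$ surjective (GNS-type construction). A pair $(\pi,\eta)$ ''can be completed to a Schürmann triple'' if there is $\psi$ such that $(\pi,\eta,\psi)$ is a Schürmann triple. A cocycle $\eta\colon A\to D$ is Gaussian if $\eta(ab)=\varepsilon(a)\eta(b)+\eta(a)\varepsilon(b)$ for all $a,b\in A$. Gaussian part: given $(\pi,\eta)$, replace $D$ by $\eta(A)$ (which is $\pi$-invariant) so that $\eta$ is surjective. Let $H$ be the completion of $D$, $H_R=\overline{\operatorname{span}}\{(\pi(a)-\varepsilon(a))v: a\in A, v\in D\}$, $H_G=H_R^\perp$, $P_G,P_R$ the orthogonal projections onto $H_G,H_R$, $D_G=P_GD$, $D_R=P_RD$, $\eta_G=P_G\circ\eta$, $\eta_R=P_R\circ\eta$. Then $\eta_G$ and $\eta_R$ are cocycles for the representations $\pi_G$ on $D_G$, $\pi_R$ on $D_R$ given by $\pi_G(a)P_G\eta(b)=\varepsilon(a)P_G\eta(b)$ and $\pi_R(a)P_R\eta(b)=(\pi(a)-\varepsilon(a))\eta(b)+\varepsilon(a)P_R\eta(b)$. A generating functional $\psi$ with (surjective) Schürmann triple $(\pi,\eta,\psi)$ admits a Lévy-Khinchin decomposition if there are generating functionals $\psi_G,\psi_R$ with $\psi=\psi_G+\psi_R$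 such that $(\pi_G,\eta_G,\psi_G)$ and $(\pi_R,\eta_R,\psi_R)$ are Schürmann triples. Properties of $(A,\varepsilon)$: (LK): every generating functional admits a Lévy-Khinchin decomposition. (GC): every Gaussian cocycle $\eta\colon A\to D$ (any pre-Hilbert space $D$) can be completed to a Schürmann triple $(\varepsilon\operatorname{id}_D,\eta,\psi)$. (NC): every pair $(\pi,\eta)$ of a unital $*$-representation $\pi$ on a pre-Hilbert space and a $\pi$-$\varepsilon$-cocycle $\eta$ with $D_G=\{0\}$ can be completed to a Schürmann triple. (AC): every pair $(\pi,\eta)$ of a unital $*$-representation $\pi$ on a pre-Hilbert space and a $\pi$-$\varepsilon$-cocycle $\eta$ can be completed to a Schürmann triple. (H$^2$Z): $H^2(A,\mathbb{C})=\{0\}$, where $H^2(A,\mathbb{C})$ is the second Hochschild cohomology of $A$ with coefficients in the bimodule $\mathbb{C}$ with actions $a.z.b=\varepsilon(a)z\varepsilon(b)$ (algebraic cochains). *)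

(* Defs.v *)
From HB Require Import structures.
From mathcomp Require Import all_boot all_order all_algebra.
From mathcomp Require Import sesquilinear complex.
From mathcomp Require Import boolp classical_sets reals.

Set Implicit Arguments.
Unset Strict Implicit.
Unset Printing Implicit Defensive.

Import Order.TTheory GRing.Theory Num.Theory.

Local Open Scope classical_set_scope.
Local Open Scope ring_scope.

(* An [algType] is associative, unital and non-trivial; the latter is no
   restriction here, as the zero algebra has no character. *)
HB.mixin Record Algebra_isStarAlgebra (C : numClosedFieldType) A
    of GRing.Algebra C A := {
  star : A -> A;
  starK : involutive star;
  starD : {morph star : a b / a + b};
  starZ : forall (c : C) (a : A), star (c *: a) = c^* *: star a;
  starM : forall a b : A, star (a * b) = star b * star a
}.

#[short(type="starAlgType")]
HB.structure Definition StarAlgebra (C : numClosedFieldType) :=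
  { A of GRing.Algebra C A & Algebra_isStarAlgebra C A }.

Record preHilbert (C : numClosedFieldType) := PreHilbert {
  carrier :> lmodType C;
  dot_form : {dot carrier for Num.conj}
}.

(* The forms [{dot _ for _}] are linear in the first argument, the inner product
   is linear in the second one. *)
Definition inner (C : numClosedFieldType) (V : preHilbert C) (u v : V) : C :=
  dot_form V v u.

Local Notation "<< u , v >>" := (inner u v) (format "<< u ,  v >>") : ring_scope.

Section HilbertSpaces.
Variable R : realType.
Local Notation C := R[i].
Implicit Types V H : preHilbert C.

Definition hnorm V (v : V) : R := Num.sqrt (complex.Re << v, v >>).

Definition complete V : Prop :=
  forall u : nat -> V,
    (forall e : R, 0 < e -> exists N, forall m n,
        (N <= m)%N -> (N <= n)%N -> hnorm (u m - u n) < e) ->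
    exists l : V, forall e : R, 0 < e -> exists N, forall n,
        (N <= n)%N -> hnorm (u n - l) < e.

Definition hclosure V (S : set V) : set V :=
  [set v | forall e : R, 0 < e -> exists2 s, S s & hnorm (v - s) < e].

Definition lspan V (S : set V) : set V :=
  [set v | exists n (c : 'I_n -> C) (s : 'I_n -> V),
      (forall i, S (s i)) /\ v = \sum_i c i *: s i].

Definition orthocomp V (S : set V) : set V :=
  [set v | forall s, S s -> << s, v >> = 0].

(* The orthogonal projection onto S (0 where it does not exist; it exists
   everywhere if V is complete and S is a closed subspace). *)
Definition proj V (S : set V) (v : V) : V :=
  xget 0 [set w | S w /\ orthocomp S (v - w)].

Definition subspace V (D : set V) : Prop :=
  D 0 /\ forall (c : C) u v, D u -> D v -> D (c *: u + v).

Definition linear_on V (W : lmodType C) (D : set V) (f : V -> W) : Prop :=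
  forall (c : C) u v, D u -> D v -> f (c *: u + v) = c *: f u + f v.

(* H, with the embedding j, is the completion of the pre-Hilbert space D;
   only the restriction of j to D is relevant. *)
Definition is_completion V (D : set V) H (j : V -> H) : Prop :=
  [/\ complete H,
      linear_on D j,
      forall u v, D u -> D v -> << j u, j v >> = << u, v >>
    & hclosure (j @` D) = [set: H]].

End HilbertSpaces.

(* Maps into and between pre-Hilbert spaces are considered on a linear subspace
   D of an ambient space V: the subspaces eta(A), D_G and D_R have to be treated
   as pre-Hilbert spaces in their own right.  The values outside D of operators
   on D are irrelevant.  A pre-Hilbert space given as a type V is the case
   D = [set: V]. *)
Section SchurmannTriples.
Variable R : realType.
Local Notation C := R[i].
Variables (A : starAlgType C) (eps : A -> C).
Implicit Types V H : preHilbert C.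

Definition character : Prop :=
  [/\ scalar eps,
      forall a b, eps (a * b) = eps a * eps b,
      forall a, eps (star a) = (eps a)^*
    & exists a, eps a != 0].

Definition hermitian_functional (psi : A -> C) : Prop :=
  forall a, psi (star a) = (psi a)^*.

Definition generating_functional (psi : A -> C) : Prop :=
  [/\ scalar psi, psi 1 = 0, hermitian_functional psi
    & forall a, eps a = 0 -> 0 <= psi (star a * a)].

(* The last condition says that pi a is adjointable on D with adjoint
   pi (star a). *)
Definition star_rep V (D : set V) (pi : A -> V -> V) : Prop :=
  subspace D
  /\ (forall a v, D v -> D (pi a v))
  /\ (forall a, linear_on D (pi a))
  /\ (forall (c : C) a b v, D v -> pi (c *: a + b) v = c *: pi a v + pi b v)
  /\ (forall a b v, D v -> pi (a * b) v = pi a (pi b v))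
  /\ (forall v, D v -> pi 1 v = v)
  /\ (forall a u v, D u -> D v -> << pi a u, v >> = << u, pi (star a) v >>).

Definition cocycle V (D : set V) (pi : A -> V -> V) (eta : A -> V) : Prop :=
  [/\ forall a, D (eta a),
      linear eta
    & forall a b, eta (a * b) = pi a (eta b) + eps b *: eta a].

Definition schurmann_triple V (D : set V) (pi : A -> V -> V) (eta : A -> V)
    (psi : A -> C) : Prop :=
  [/\ star_rep D pi,
      cocycle D pi eta,
      scalar psi,
      hermitian_functional psi
    & forall a b, eps a * psi b - psi (a * b) + psi a * eps b
                  = - << eta (star a), eta b >>].

Definition completable V (D : set V) (pi : A -> V -> V) (eta : A -> V) : Prop :=
  exists psi : A -> C, schurmann_triple D pi eta psi.

Definition gaussian V (eta : A -> V) : Prop :=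
  linear eta /\ forall a b, eta (a * b) = eps a *: eta b + eps b *: eta a.

(* Here j embeds eta(A) into its completion H; pi and eta are restricted to
   the pre-Hilbert space eta(A), which is the range of eta. *)
Section GaussianPart.
Variables (V : preHilbert C) (pi : A -> V -> V) (eta : A -> V).
Variables (H : preHilbert C) (j : V -> H).

Definition H_R : set H :=
  hclosure (lspan [set w | exists a, exists2 v, range eta v
                         & w = j (pi a v - eps a *: v)]).

Definition H_G : set H := orthocomp H_R.

Definition P_R : H -> H := proj H_R.

Definition P_G : H -> H := proj H_G.

Definition D_R : set H := P_R @` (j @` range eta).

Definition D_G : set H := P_G @` (j @` range eta).

Definition eta_R (a : A) : H := P_R (j (eta a)).

Definition eta_G (a : A) : H := P_G (j (eta a)).

(* The defining formulas of pi_R and pi_G, which determine them on D_R and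
   D_G. *)
Definition is_pi_R (piR : A -> H -> H) : Prop :=
  forall a b, piR a (P_R (j (eta b)))
              = j (pi a (eta b) - eps a *: eta b) + eps a *: P_R (j (eta b)).

Definition is_pi_G (piG : A -> H -> H) : Prop :=
  forall a b, piG a (P_G (j (eta b))) = eps a *: P_G (j (eta b)).

Definition LK_decomposition (psi psiG psiR : A -> C) : Prop :=
  [/\ generating_functional psiG,
      generating_functional psiR,
      forall a, psi a = psiG a + psiR a,
      exists2 piG, is_pi_G piG & schurmann_triple D_G piG eta_G psiG
    & exists2 piR, is_pi_R piR & schurmann_triple D_R piR eta_R psiR].

End GaussianPart.

(* The surjective Schurmann triple of psi and the completion exist and are
   unique up to unitary equivalence; we quantify over all of them. *)
Definition admits_LK (psi : A -> C) : Prop :=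
  forall V (pi : A -> V -> V) (eta : A -> V),
    schurmann_triple [set: V] pi eta psi -> range eta = [set: V] ->
  forall H (j : V -> H), is_completion (range eta) j ->
    exists psiG psiR, LK_decomposition pi eta j psi psiG psiR.

Definition has_LK : Prop :=
  forall psi, generating_functional psi -> admits_LK psi.

Definition has_GC : Prop :=
  forall V (eta : A -> V), gaussian eta ->
    completable [set: V] (fun a v => eps a *: v) eta.

Definition has_NC : Prop :=
  forall V (pi : A -> V -> V) (eta : A -> V),
    star_rep [set: V] pi -> cocycle [set: V] pi eta ->
  forall H (j : V -> H), is_completion (range eta) j ->
    D_G pi eta j = [set 0] ->
    completable [set: V] pi eta.

Definition has_AC : Prop :=
  forall V (pi : A -> V -> V) (eta : A -> V),
    star_rep [set: V] pi -> cocycle [set: V] pi eta ->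
    completable [set: V] pi eta.

(* Hochschild 2-cocycles and 2-coboundaries with coefficients in the bimodule C
   with actions a.z.b = eps a * z * eps b. *)
Definition Z2 : set (A -> A -> C) :=
  [set c | [/\ forall b, scalar (c^~ b),
               forall a, scalar (c a)
             & forall a b d, eps a * c b d - c (a * b) d + c a (b * d)
                             - c a b * eps d = 0]].

Definition B2 : set (A -> A -> C) :=
  [set c | exists2 f : A -> C, scalar f
           & forall a b, c a b = eps a * f b - f (a * b) + f a * eps b].

(* H^2(A, C) = Z2 / B2 is zero. *)
Definition has_H2Z : Prop := Z2 `<=` B2.

End SchurmannTriples.

(* Main.v *)
Require Import Defs.
From HB Require Import structures.
From mathcomp Require Import all_boot all_order all_algebra.
From mathcomp Require Import sesquilinear complex.
From mathcomp Require Import boolp classical_sets reals.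
From mathcomp Require Import ssrAC ring lra.

Set Implicit Arguments.
Unset Strict Implicit.
Unset Printing Implicit Defensive.

Import Order.TTheory GRing.Theory Num.Theory.

Local Open Scope classical_set_scope.
Local Open Scope ring_scope.

(** Each pair is the unitization A = C 1 + K of a small non-unital star-algebra
    K, with the character that annihilates K.  Since a cocycle eta vanishes at
    1 and satisfies eta (k l) = pi k (eta l) on K, the pair (pi, eta) can be
    completed exactly when k l |-> <eta (star k), eta l> defines a linear
    functional on the span of the products in K.  Hence every vanishing sum of
    products in K is a possible obstruction, and everything depends on which
    cocycles exist; the latter is restricted by the fact that star a * a = 0
    forces pi a = 0.

    - K = C x with x = star x and x^2 = 0.  All representations kill K, so all
      cocycles are Gaussian and (NC) holds for want of non-zero cocycles to
      complete; but eta x = 1 is a Gaussian cocycle with <eta x, eta x> <> 0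
      and x^2 = 0, which refutes (GC), hence (AC).
    - K = x C[x] / (x^3).  Again all representations kill K.  A cocycle
      satisfies eta (x^2) = 0 and is completed by psi (x^2) = <eta x, eta x>,
      so (AC) holds, while the Hochschild cocycle with
      c (x, x^2) = c (x^2, x) = 1 is not a coboundary as x x^2 = 0.
    - K = span (e, p, q) with star e = e, star p = q and e e = e, p e = p,
      e q = q, all other products of generators being 0.  Since K is spanned by
      products, it has no non-zero Gaussian cocycle and (GC) holds.  But
      p q = 0 although the cocycle eta q = 1, over the one-dimensional
      representation with e |-> 1, has <eta (star p), eta q> = 1: this refutes
      (NC), hence (AC).
    - The direct sum of the first and the third K.  Both obstructions
      survive, refuting (GC) and (NC).  In a triple with psi, however,
      star k * k = 0 forces eta k = 0, so the cocycles behind the two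
      obstructions do not come from generating functionals, and e acts as the
      identity on the range of eta.  Then H_G = 0, and psi = 0 + psi is a
      Levy-Khinchin decomposition. *)

(** * Unitizations of star-algebras *)

Lemma linear_facts (F : pzRingType) (U W : lmodType F) (f : U -> W) : linear f ->
  [/\ f 0 = 0, {morph f : u v / u + v} & forall c u, f (c *: u) = c *: f u].
Proof.
move=> fZD.
have f0 : f 0 = 0 by have := fZD (-1) 0 0; rewrite !scaleN1r addr0 oppr0 addNr.
split=> // [u v | c u]; first by have := fZD 1 u v; rewrite !scale1r.
by have := fZD c u 0; rewrite f0 !addr0.
Qed.

(** A star-algebra that need not have a unit; it plays the role of ker eps. *)
Record nuStarAlg (C : numClosedFieldType) := NuStarAlg {
  nu_car :> lmodType C;
  nu_mul : nu_car -> nu_car -> nu_car;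
  nu_star : nu_car -> nu_car;
  nu_mulA : associative nu_mul;
  nu_mulPl : forall l, linear (nu_mul^~ l);
  nu_mulPr : forall k, linear (nu_mul k);
  nu_starK : involutive nu_star;
  nu_starP : forall c k l, nu_star (c *: k + l) = c^* *: nu_star k + nu_star l;
  nu_starM : forall k l, nu_star (nu_mul k l) = nu_mul (nu_star l) (nu_star k)
}.

Definition unitization (C : numClosedFieldType) (K : nuStarAlg C) : Type :=
  (C^o * K)%type.

Section Unitization.
Variables (C : numClosedFieldType) (K : nuStarAlg C).
Local Notation A := (unitization K).
Local Notation "k ** l" := (nu_mul k l) (at level 40).

HB.instance Definition _ := GRing.Lmodule.copy A (C^o * K)%type.

Lemma nu_mul0l (l : K) : 0 ** l = 0.
Proof. by have [] := linear_facts (@nu_mulPl C K l). Qed.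

Lemma nu_mul0r (k : K) : k ** 0 = 0.
Proof. by have [] := linear_facts (@nu_mulPr C K k). Qed.

Lemma nu_mulZl c (k l : K) : (c *: k) ** l = c *: (k ** l).
Proof. by have [_ _ ->] := linear_facts (@nu_mulPl C K l). Qed.

Lemma nu_mulZr c (k l : K) : k ** (c *: l) = c *: (k ** l).
Proof. by have [_ _ ->] := linear_facts (@nu_mulPr C K k). Qed.

Lemma nu_mulDl (k l m : K) : (k + l) ** m = k ** m + l ** m.
Proof. by have [_ -> _] := linear_facts (@nu_mulPl C K m). Qed.

Lemma nu_mulDr (k l m : K) : m ** (k + l) = m ** k + m ** l.
Proof. by have [_ -> _] := linear_facts (@nu_mulPr C K m). Qed.

Lemma nu_starD : {morph @nu_star C K : k l / k + l}.
Proof. by move=> k l; have := nu_starP 1 k l; rewrite rmorph1 !scale1r. Qed.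

Lemma nu_star0 : nu_star (0 : K) = 0.
Proof.
by have := nu_starP (-1) (0 : K) 0; rewrite rmorphN1 !scaleN1r addr0 oppr0 addNr.
Qed.

Lemma nu_starZ c (k : K) : nu_star (c *: k) = c^* *: nu_star k.
Proof. by have := nu_starP c k 0; rewrite nu_star0 !addr0. Qed.

Definition u_one : A := (1, 0).
Definition u_mul (a b : A) : A :=
  (a.1 * b.1, a.1 *: b.2 + b.1 *: a.2 + a.2 ** b.2).
Definition u_star (a : A) : A := (a.1^*, nu_star a.2).

Fact u_mulA : associative u_mul.
Proof.
move=> [a k] [b l] [c m]; congr (_, _) => /=; first exact: mulrA.
rewrite !nu_mulDl !nu_mulDr !nu_mulZl !nu_mulZr nu_mulA !scalerDr !scalerA.
by rewrite (mulrC c a) (mulrC c b) [LHS](AC (4*3) ((1*(2*4*6))*(3*5*7))).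
Qed.

Fact u_mul1l : left_id u_one u_mul.
Proof. by case=> a k; rewrite /u_mul /= mul1r scale1r scaler0 nu_mul0l !addr0. Qed.

Fact u_mul1r : right_id u_one u_mul.
Proof.
by case=> a k; rewrite /u_mul /= mulr1 scale1r scaler0 nu_mul0r addr0 add0r.
Qed.

Fact u_mulDl : left_distributive u_mul +%R.
Proof.
move=> [a k] [b l] [c m]; congr (_, _) => /=; first exact: mulrDl.
by rewrite nu_mulDl scalerDl scalerDr [LHS](AC (2*2*2) ((1*3*5)*(2*4*6))).
Qed.

Fact u_mulDr : right_distributive u_mul +%R.
Proof.
move=> [a k] [b l] [c m]; congr (_, _) => /=; first exact: mulrDr.
by rewrite nu_mulDr scalerDl scalerDr [LHS](AC (2*2*2) ((1*3*5)*(2*4*6))).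
Qed.

Fact u_one_neq0 : u_one != 0 :> A.
Proof. by apply/eqP => -[/eqP]; rewrite oner_eq0. Qed.

HB.instance Definition _ := GRing.Zmodule_isNzRing.Build A
  u_mulA u_mul1l u_mul1r u_mulDl u_mulDr u_one_neq0.

Fact u_scaleAl (c : C) (a b : A) : c *: (a * b) = (c *: a) * b.
Proof.
case: a b => [a k] [b l]; congr (_, _) => /=; first exact: mulrA.
by rewrite nu_mulZl !scalerDr !scalerA (mulrC b).
Qed.

HB.instance Definition _ := GRing.Lmodule_isLalgebra.Build C A u_scaleAl.

Fact u_scaleAr (c : C) (a b : A) : c *: (a * b) = a * (c *: b).
Proof.
case: a b => [a k] [b l]; congr (_, _) => /=; first exact: mulrCA.
by rewrite nu_mulZr !scalerDr !scalerA (mulrC a).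
Qed.

HB.instance Definition _ := GRing.Lalgebra_isAlgebra.Build C A u_scaleAr.

Fact u_starK : involutive u_star.
Proof. by case=> a k; rewrite /u_star /= conjCK nu_starK. Qed.

Fact u_starD : {morph u_star : a b / a + b}.
Proof. by move=> [a k] [b l]; rewrite /u_star /= rmorphD nu_starD. Qed.

Fact u_starZ (c : C) (a : A) : u_star (c *: a) = c^* *: u_star a.
Proof. by case: a => a k; rewrite /u_star /= nu_starZ rmorphM. Qed.

Fact u_starM (a b : A) : u_star (a * b) = u_star b * u_star a.
Proof.
case: a b => [a k] [b l]; congr (_, _) => /=; first by rewrite rmorphM mulrC.
by rewrite !nu_starD !nu_starZ nu_starM [X in X + _]addrC.
Qed.

HB.instance Definition _ := Algebra_isStarAlgebra.Build C A
  u_starK u_starD u_starZ u_starM.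

End Unitization.

Definition aug (C : numClosedFieldType) (K : nuStarAlg C) (a : unitization K) : C :=
  a.1.

Definition incl (C : numClosedFieldType) (K : nuStarAlg C) (k : K) :
  unitization K := (0, k).

(** * Inner products and projections *)

Section InnerProduct.
Variables (R : realType) (V : preHilbert R[i]).
Implicit Types (u v w s : V) (c : R[i]).

Lemma inner_linear u : scalar (inner u).
Proof. by move=> c v w; rewrite /inner linearPl. Qed.

Lemma inner_conj u v : (inner u v)^* = inner v u.
Proof.
by rewrite /inner [RHS](@hermitian_subproof _ _ _ _ (dot_form V)) expr0 mul1r.
Qed.

Lemma inner0r u : inner u 0 = 0.
Proof. by rewrite /inner linear0l. Qed.

Lemma inner0l u : inner 0 u = 0.
Proof. by rewrite -[LHS]inner_conj inner0r conjC0. Qed.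

Lemma innerZr c u v : inner u (c *: v) = c * inner u v.
Proof. by rewrite -[c *: v]addr0 inner_linear inner0r addr0. Qed.

Lemma innerZl c u v : inner (c *: u) v = c^* * inner u v.
Proof. by rewrite -[LHS]inner_conj innerZr rmorphM /= inner_conj. Qed.

Lemma innerBr u v w : inner u (v - w) = inner u v - inner u w.
Proof. by rewrite addrC -scaleN1r inner_linear mulN1r addrC. Qed.

Lemma innerBl u v w : inner (u - v) w = inner u w - inner v w.
Proof. by rewrite -[LHS]inner_conj innerBr rmorphB /= !inner_conj. Qed.

Lemma inner_ge0 v : 0 <= inner v v.
Proof.
have [->|v_neq0] := eqVneq v 0; first by rewrite inner0r.
exact/ltW/neq0_dnorm_gt0.
Qed.

Lemma inner_eq0 v : inner v v = 0 -> v = 0.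
Proof.
move=> vv0; apply/eqP; apply: contraT => /(@neq0_dnorm_gt0 _ _ _ (dot_form V)).
by rewrite -/(inner v v) vv0 ltxx.
Qed.

Lemma hnorm0 : hnorm (0 : V) = 0.
Proof. by rewrite /hnorm inner0r sqrtr0. Qed.

Lemma hnorm_small_eq0 v : (forall e : R, 0 < e -> hnorm v < e) -> v = 0.
Proof.
move=> vsmall; apply: inner_eq0; have := inner_ge0 v.
rewrite lecE => /andP[/eqP im0 re0].
suff re_le0 : complex.Re (inner v v) <= 0.
  by apply/eqP; rewrite eq_complex im0 eqxx andbT eq_le re_le0 re0.
rewrite leNgt -sqrtr_gt0; apply/negP => /vsmall.
by rewrite ltxx.
Qed.

(** Pythagoras: |w - s|^2 = |w|^2 + |s|^2. *)
Lemma hnorm_orthogonal w s : inner s w = 0 -> hnorm w <= hnorm (w - s).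
Proof.
move=> sw0; apply: ler_wsqrtr.
suff : inner w w <= inner (w - s) (w - s) by rewrite lecE => /andP[].
rewrite innerBr !innerBl sw0 -[inner w s]inner_conj sw0 conjC0 subr0 sub0r opprK.
by rewrite lerDl inner_ge0.
Qed.

Lemma sub_hclosure_lspan (S : set V) : S `<=` hclosure (lspan S).
Proof.
move=> v Sv e e_gt0; exists v; last by rewrite subrr hnorm0.
by exists 1%N, (fun=> 1), (fun=> v); split=> //; rewrite big_ord1 scale1r.
Qed.

Lemma hclosure_lspan0 (S : set V) : S `<=` [set 0] -> hclosure (lspan S) `<=` [set 0].
Proof.
move=> S0 v clv; apply: hnorm_small_eq0 => e /clv[_ [n [c [s [Ss ->]]]]].
by rewrite big1 ?subr0// => i _; rewrite (S0 _ (Ss i)) scaler0.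
Qed.

Lemma dense_orthocomp0 (S : set V) : hclosure S = [set: V] ->
  orthocomp S `<=` [set 0].
Proof.
move=> densS w Sw; apply: hnorm_small_eq0 => e e_gt0.
have [||s Ss sw] := (_ : hclosure S w) e => //; first by rewrite densS.
exact: le_lt_trans (hnorm_orthogonal (Sw s Ss)) sw.
Qed.

Lemma subset_set0 (S : set V) : S 0 -> S `<=` [set 0] -> S = [set 0].
Proof. by move=> S0 sS; apply/seteqP; split=> // _ ->. Qed.

Lemma orthocomp_0 (S : set V) : orthocomp S 0.
Proof. by move=> s _; apply: inner0r. Qed.

Lemma proj_set0 (v : V) : proj [set 0] v = 0.
Proof. by rewrite /proj; case: xgetP => // w _ []. Qed.

Lemma proj_id (S : set V) v : S v -> orthocomp S `<=` [set 0] -> proj S v = v.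
Proof.
move=> Sv S0; apply: xget_unique.
  by split=> //; rewrite subrr; apply: orthocomp_0.
by move=> w [_ /S0/eqP]; rewrite subr_eq0 eq_sym => /eqP.
Qed.

Lemma orthocompT : orthocomp [set: V] `<=` [set 0].
Proof. by move=> w Sw; apply: inner_eq0; apply: Sw. Qed.

End InnerProduct.

(** * The scalars as a Hilbert space *)

(** Linear in the first argument, as forms of type [{dot _ for _}] are. *)
Definition scalar_dot (C : numClosedFieldType) (u v : C^o) : C := u * v^*.

Section ScalarDot.
Variable C : numClosedFieldType.

Fact scalar_dotBl v : zmod_morphism ((@scalar_dot C)^~ v).
Proof. by move=> u w; rewrite /scalar_dot mulrBl. Qed.

Fact scalar_dotBr u : zmod_morphism (@scalar_dot C u).
Proof. by move=> v w; rewrite /scalar_dot rmorphB mulrBr. Qed.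

Fact scalar_dotZl v : scalable_for *%R ((@scalar_dot C)^~ v).
Proof. by move=> c u; rewrite /scalar_dot -mulrA. Qed.

Fact scalar_dotZr u : scalable_for (Num.conj \; *%R) (@scalar_dot C u).
Proof. by move=> c v; rewrite /scalar_dot rmorphM mulrCA. Qed.

HB.instance Definition _ := isBilinear.Build C C^o C^o C _ _ (@scalar_dot C)
  scalar_dotBl scalar_dotBr scalar_dotZl scalar_dotZr.

Fact scalar_dot_hermitian (u v : C^o) :
  scalar_dot u v = (-1) ^+ false * (scalar_dot v u)^*.
Proof. by rewrite expr0 mul1r /scalar_dot rmorphM /= conjCK mulrC. Qed.

HB.instance Definition _ := isHermitianSesquilinear.Build C C^o false Num.conj
  (@scalar_dot C) scalar_dot_hermitian.

Fact scalar_dot_gt0 (u : C^o) : u != 0 -> 0 < scalar_dot u u.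
Proof. by move=> u_neq0; rewrite /scalar_dot -normCK exprn_gt0// normr_gt0. Qed.

HB.instance Definition _ := isDotProduct.Build C C^o (@scalar_dot C) scalar_dot_gt0.

Definition scalars : preHilbert C := @PreHilbert C C^o (@scalar_dot C).

End ScalarDot.

Section Completeness.
Variable R : realType.

Lemma real_cauchy_converges (u : nat -> R) :
  (forall e : R, 0 < e -> exists N, forall m n,
     (N <= m)%N -> (N <= n)%N -> `|u m - u n| < e) ->
  exists l : R, forall e : R, 0 < e -> exists N, forall n,
    (N <= n)%N -> `|u n - l| < e.
Proof.
(* The limit is the supremum of the reals that are eventually below u. *)
move=> cauchy_u; pose E := [set x | exists N, forall n, (N <= n)%N -> x <= u n].
pose tail e N := forall m n, (N <= m)%N -> (N <= n)%N -> `|u m - u n| < e.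
have low e N : tail e N -> E (u N - e).
  move=> Ne; exists N => n Nn; rewrite lerBlDl.
  have := ltW (Ne N n (leqnn N) Nn); rewrite ler_distl => /andP[].
  by rewrite lerBlDl addrC; lra.
have up e N : tail e N -> ubound E (u N + e).
  move=> Ne x [M xM].
  apply: le_trans (xM (maxn M N) (leq_maxl _ _)) _.
  have := ltW (Ne _ N (leq_maxr M N) (leqnn N)); rewrite ler_distl => /andP[_].
  by lra.
have supE : has_sup E.
  have [N Ne] := cauchy_u 1 ltr01.
  by split; [exists (u N - 1); apply: low | exists (u N + 1); apply: up].
exists (sup E) => e e_gt0; have e2 : 0 < e / 2 by lra.
have [N Ne] := cauchy_u _ e2; exists N => n Nn.
have := sup_upper_bound supE (low _ _ Ne).
have := ge_sup supE.1 (up _ _ Ne).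
have := Ne n N Nn (leqnn N); rewrite !ltr_distl => /andP[? ?] ? ?.
by apply/andP; split; lra.
Qed.

Lemma hnorm_scalars (v : scalars R[i]) :
  hnorm v = Num.sqrt (complex.Re v ^+ 2 + complex.Im v ^+ 2).
Proof.
rewrite /hnorm /inner /= /scalar_dot -normCK.
by have := add_Re2_Im2 (v : R[i]) => <-.
Qed.

Lemma Re_le_hnorm (v : scalars R[i]) : `|complex.Re v| <= hnorm v.
Proof.
by rewrite hnorm_scalars -sqrtr_sqr; apply: ler_wsqrtr; rewrite lerDl sqr_ge0.
Qed.

Lemma Im_le_hnorm (v : scalars R[i]) : `|complex.Im v| <= hnorm v.
Proof.
by rewrite hnorm_scalars -sqrtr_sqr; apply: ler_wsqrtr; rewrite lerDr sqr_ge0.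
Qed.

Lemma hnorm_le_ReDIm (v : scalars R[i]) :
  hnorm v <= `|complex.Re v| + `|complex.Im v|.
Proof.
rewrite hnorm_scalars -[leRHS]ger0_norm ?addr_ge0// -[leRHS]sqrtr_sqr.
apply: ler_wsqrtr.
rewrite sqrrD !real_normK ?num_real// addrAC lerDl.
by rewrite mulrn_wge0// mulr_ge0.
Qed.

Lemma scalars_complete : complete (scalars R[i]).
Proof.
have ReB (x y : R[i]) : complex.Re (x - y) = complex.Re x - complex.Re y.
  by case: x y => ? ? [].
have ImB (x y : R[i]) : complex.Im (x - y) = complex.Im x - complex.Im y.
  by case: x y => ? ? [].
move=> u cauchy_u.
have [|x ux] := @real_cauchy_converges (fun n => complex.Re (u n)).
  move=> e /cauchy_u[N Ne]; exists N => m n Nm Nn; rewrite -ReB.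
  by apply: le_lt_trans (Ne _ _ Nm Nn); apply: Re_le_hnorm.
have [|y uy] := @real_cauchy_converges (fun n => complex.Im (u n)).
  move=> e /cauchy_u[N Ne]; exists N => m n Nm Nn; rewrite -ImB.
  by apply: le_lt_trans (Ne _ _ Nm Nn); apply: Im_le_hnorm.
exists (x +i* y)%C => e e_gt0; have e2 : 0 < e / 2 by lra.
have [[M Me] [N Ne]] := (ux _ e2, uy _ e2); exists (maxn M N) => n.
rewrite geq_max => /andP[/Me xn /Ne yn].
apply: le_lt_trans (hnorm_le_ReDIm _) _; rewrite ReB ImB.
by rewrite [ltRHS]splitr ltrD.
Qed.

Lemma scalars_completion : is_completion [set: scalars R[i]] id.
Proof.
split=> //; first exact: scalars_complete.
apply/seteqP; split=> // v _ e e_gt0; exists v; first by exists v.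
by rewrite subrr hnorm0.
Qed.

End Completeness.

(** * Cocycles and completability *)

Section Comparison.
Variables (R : realType) (A : starAlgType R[i]) (eps : A -> R[i]).

Lemma AC_NC : has_AC eps -> has_NC eps.
Proof. by move=> ac V pi eta repV cocV H j _ _; apply: ac. Qed.

Lemma character1 : character eps -> eps 1 = 1.
Proof.
move=> [_ epsM _ [a a0]]; apply: (mulfI a0).
by rewrite -epsM !mulr1.
Qed.

Lemma gaussian_star_rep (V : preHilbert R[i]) : character eps ->
  star_rep [set: V] (fun a v => eps a *: v).
Proof.
move=> char_eps; have eps1 := character1 char_eps.
case: char_eps => epsZD epsM epsS _.
do !split=> //.
- by move=> a c u v _ _; rewrite scalerDr !scalerA mulrC.
- by move=> c a b v _; rewrite epsZD scalerDl scalerA.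
- by move=> a b v _; rewrite epsM scalerA.
- by move=> v _; rewrite eps1 scale1r.
- by move=> a u v _ _; rewrite innerZl innerZr epsS.
Qed.

Lemma gaussian_cocycle (V : preHilbert R[i]) (eta : A -> V) : gaussian eps eta ->
  cocycle eps [set: V] (fun a v => eps a *: v) eta.
Proof. by case. Qed.

Lemma AC_GC : character eps -> has_AC eps -> has_GC eps.
Proof.
move=> char_eps ac V eta gauss; apply: ac; first exact: gaussian_star_rep.
exact: gaussian_cocycle.
Qed.

(** Positivity: the square of the norm of pi a v is <v, pi (star a * a) v>. *)
Lemma star_rep_eq0 (V : preHilbert R[i]) (pi : A -> V -> V) a :
  star_rep [set: V] pi ->
  (forall v, pi (star a * a) v = 0) -> forall v, pi a v = 0.
Proof.
move=> [_ [_ [_ [_ [piM [_ piS]]]]]] aa0 v.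
by apply: inner_eq0; rewrite piS// -piM// aa0 inner0r.
Qed.

Lemma cocycle1 (V : preHilbert R[i]) (D : set V) pi (eta : A -> V) :
  character eps -> star_rep D pi -> cocycle eps D pi eta -> eta 1 = 0.
Proof.
move=> /character1 eps1 [_ [_ [_ [_ [_ [pi1 _]]]]]] [Deta _ etaM].
apply/eqP; have /eqP := etaM 1 1; rewrite mulr1 eps1 scale1r pi1//.
by rewrite -subr_eq0 opprD addNKr oppr_eq0.
Qed.

End Comparison.

Section AugmentationIdeal.
Variables (R : realType) (K : nuStarAlg R[i]).
Local Notation A := (unitization K).
Local Notation eps := (@aug _ K).
Local Notation "k ** l" := (nu_mul k l) (at level 40).
Implicit Types (k l : K) (a b : A).

Lemma aug_character : character eps.
Proof. by split=> //; exists 1; apply: oner_neq0. Qed.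

Lemma incl_decomp a : a = a.1 *: 1 + incl a.2.
Proof.
case: a => c k.
by congr (_, _); rewrite /= ?addr0 ?[_ *: _]mulr1 ?scaler0 ?add0r.
Qed.

Lemma inclM k l : incl (k ** l) = incl k * incl l.
Proof. by congr (_, _); rewrite /= ?mulr0// !scale0r !add0r. Qed.

Lemma star_incl k : star (incl k) = incl (nu_star k).
Proof. by congr (_, _); rewrite /= conjC0. Qed.

Lemma incl0 : incl (0 : K) = 0.
Proof. by []. Qed.

Section Cocycles.
Variables (V : preHilbert R[i]) (pi : A -> V -> V) (eta : A -> V).
Hypotheses (pi_rep : star_rep [set: V] pi) (eta_coc : cocycle eps [set: V] pi eta).

Lemma cocycle_incl a : eta a = eta (incl a.2).
Proof.
case: (eta_coc) => _ etaZD _; rewrite {1}(incl_decomp a) etaZD.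
by rewrite (cocycle1 aug_character pi_rep eta_coc) scaler0 add0r.
Qed.

Lemma cocycle_inclM k l : eta (incl (k ** l)) = pi (incl k) (eta (incl l)).
Proof. by case: eta_coc => _ _ etaM; rewrite inclM etaM scale0r addr0. Qed.

Lemma star_rep_incl a v : pi a v = a.1 *: v + pi (incl a.2) v.
Proof.
case: pi_rep => _ [_ [_ [piZD [_ [pi1 _]]]]].
by rewrite {1}(incl_decomp a) piZD// pi1.
Qed.

(** Only the values on K matter: the coboundary equation at (a, b) reduces to
    the equation at the components in K, as psi and eta vanish at 1. *)
Lemma completable_incl (psi : K -> R[i]) : scalar psi ->
  (forall k, psi (nu_star k) = (psi k)^*) ->
  (forall k l, psi (k ** l) = inner (eta (incl (nu_star k))) (eta (incl l))) ->
  completable eps [set: V] pi eta.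
Proof.
move=> psiZD psiS psiM; exists (fun a => psi a.2); split=> //.
- by move=> c a b; apply: psiZD.
- by move=> a; apply: psiS.
move=> a b; rewrite (cocycle_incl (star a)) (cocycle_incl b) -psiM /=.
have [_ psiD psiZ] := @linear_facts _ K R[i]^o psi psiZD.
by rewrite !psiD !psiZ /aug /GRing.scale /=; ring.
Qed.

Lemma completable_zero : (forall k, eta (incl k) = 0) ->
  completable eps [set: V] pi eta.
Proof.
move=> eta0; apply: (@completable_incl (fun=> 0)).
- by move=> c k l; rewrite mulr0 addr0.
- by move=> k; rewrite conjC0.
- by move=> k l; rewrite eta0 inner0l.
Qed.

End Cocycles.

Lemma schurmann_incl (V : preHilbert R[i]) (D : set V) pi (eta : A -> V) psi :
  schurmann_triple eps D pi eta psi -> forall k l,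
  psi (incl (k ** l)) = inner (eta (incl (nu_star k))) (eta (incl l)).
Proof.
move=> [_ _ _ _ eq_psi] k l; have := eq_psi (incl k) (incl l).
by rewrite /aug /= mul0r mulr0 addr0 sub0r -star_incl -inclM => /oppr_inj.
Qed.

Lemma star_rep_nil (V : preHilbert R[i]) (pi : A -> V -> V) k :
  star_rep [set: V] pi -> (forall v, pi (incl (nu_star k ** k)) v = 0) ->
  forall v, pi (incl k) v = 0.
Proof.
by move=> pi_rep kk0; apply: star_rep_eq0 => // v; rewrite star_incl -inclM.
Qed.

Lemma star_rep0 (V : preHilbert R[i]) (pi : A -> V -> V) v :
  star_rep [set: V] pi -> pi (incl 0) v = 0.
Proof.
move=> [_ [_ [_ [piZD _]]]].
by have [] := @linear_facts _ A V (pi^~ v) (fun c a b => piZD c a b v I).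
Qed.

(** The Gaussian cocycle a |-> f a.2 cannot be completed: psi (x ** x) would have
    to be both 0 and <f x, f x> = 1. *)
Lemma not_GC (f : K -> R[i]) x : scalar f -> (forall k l, f (k ** l) = 0) ->
  nu_star x = x -> x ** x = 0 -> f x = 1 -> ~ has_GC eps.
Proof.
move=> fZD fM xS xx fx.
have [f0 fD fZ] := @linear_facts _ K R[i]^o f fZD.
move=> /(_ (scalars R[i]) (fun a => f a.2)) [|psi psi_triple].
  split; first by move=> c a b; apply: fZD.
  by move=> a b; rewrite /= !fD !fZ fM addr0.
have := schurmann_incl psi_triple x x; rewrite xx xS incl0 /= fx.
case: psi_triple => _ _ psiZD _ _.
have [-> _ _] := @linear_facts _ A R[i]^o psi psiZD.
by rewrite /inner /= /scalar_dot conjC1 mulr1 => /esym/eqP; rewrite oner_eq0.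
Qed.

End AugmentationIdeal.

(** * Vanishing and full Gaussian part *)

Section GaussianPart.
Variables (R : realType) (A : starAlgType R[i]) (eps : A -> R[i]).
Variables (V : preHilbert R[i]) (pi : A -> V -> V) (eta : A -> V).
Variables (H : preHilbert R[i]) (j : V -> H).
Hypothesis j_compl : is_completion (range eta) j.

(** The opposite extreme to a Gaussian pair: v = (pi a - eps a) v puts the whole
    range into H_R without closures or sums. *)
Definition nondegenerate : Prop :=
  forall v, range eta v -> exists2 a, eps a = 0 & pi a v = v.

Lemma nondegenerate_H_R v : nondegenerate -> range eta v ->
  H_R eps pi eta j (j v).
Proof.
move=> nondeg eta_v; apply: sub_hclosure_lspan.
have [a a0 av] := nondeg v eta_v; exists a, v => //.
by rewrite a0 scale0r subr0 av.
Qed.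

Lemma nondegenerate_H_G : nondegenerate -> H_G eps pi eta j = [set 0].
Proof.
move=> nondeg; apply: subset_set0; first exact: orthocomp_0.
case: j_compl => _ _ _ dense_j w Gw.
apply: (dense_orthocomp0 dense_j) => _ [v eta_v <-].
exact/Gw/nondegenerate_H_R.
Qed.

Lemma D_G_eq0 : H_G eps pi eta j = [set 0] -> D_G eps pi eta j = [set 0].
Proof.
move=> HG0; apply/seteqP; split=> [_ [w _ <-] | _ ->].
  by rewrite /P_G HG0 /= proj_set0.
exists (j (eta 0)); last by rewrite /P_G HG0 proj_set0.
by exists (eta 0) => //; exists 0.
Qed.

Lemma H_G_top : linear eta ->
  (forall a v, range eta v -> pi a v = eps a *: v) -> H_G eps pi eta j = [set: H].
Proof.
move=> /linear_facts[eta0 _ _] gauss.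
have j0 : j 0 = 0.
  case: j_compl => _ jZD _ _; have ran0 : range eta 0 by exists 0.
  by have := jZD (-1) 0 0 ran0 ran0; rewrite !scaleN1r oppr0 addr0 addNr.
apply/seteqP; split=> // w _ s.
move=> /(hclosure_lspan0 _) -> ; first exact: inner0l.
by move=> _ [a [v eta_v ->]]; rewrite gauss// subrr j0.
Qed.

Lemma D_G_top : H_G eps pi eta j = [set: H] -> D_G eps pi eta j = j @` range eta.
Proof.
move=> HGT; have PG w : P_G eps pi eta j w = w.
  by rewrite /P_G HGT; apply: proj_id => //; apply: orthocompT.
by rewrite /D_G; apply/seteqP; split=> [_ [w jw <-] | w jw]; [rewrite PG | exists w].
Qed.

Lemma completion_inj : linear eta -> {in range eta &, injective j}.
Proof.
case: j_compl => _ jZD jI _ etaZD u v; rewrite !inE => eta_u eta_v juv.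
apply/eqP; rewrite -subr_eq0; apply/eqP; apply: inner_eq0.
have eta_vu : range eta (u - v).
  move: eta_u eta_v => [a _ <-] [b _ <-]; exists (a - b) => //.
  by rewrite [a - b]addrC -[- b]scaleN1r etaZD scaleN1r addrC.
rewrite -jI// [u - v]addrC -[- v]scaleN1r jZD// juv.
by rewrite scaleN1r addNr inner0r.
Qed.

End GaussianPart.

Section PurelyNonGaussian.
Variables (R : realType) (A : starAlgType R[i]) (eps : A -> R[i]).
Variables (V : preHilbert R[i]) (pi : A -> V -> V) (eta : A -> V) (psi : A -> R[i]).
Variables (H : preHilbert R[i]) (j : V -> H).

Lemma generating_functional0 : generating_functional eps (fun=> 0).
Proof.
by split=> // [c a b | a]; rewrite ?mulr0 ?addr0 ?conjC0.
Qed.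

(** With H_G = 0 and j (eta a) in H_R, the projections are 0 and the identity on
    the range of j, so the decomposition is the given triple transported by j. *)
Lemma LK_of_nondegenerate : character eps -> generating_functional eps psi ->
  schurmann_triple eps [set: V] pi eta psi -> range eta = [set: V] ->
  is_completion (range eta) j -> nondegenerate eps pi eta ->
  LK_decomposition eps pi eta j psi (fun=> 0) psi.
Proof.
move=> char_eps psi_gen [pi_rep eta_coc psiZD psiS psiM] eta_onto j_compl nondeg.
have [_ etaZD etaM] := eta_coc.
have HG0 := nondegenerate_H_G j_compl nondeg.
have inj_j : injective j.
  by move=> u v; apply: (completion_inj j_compl etaZD) => //; rewrite inE eta_onto.
have [_ jZD jI _] := j_compl; rewrite eta_onto in jZD jI.
have [j0 jD jZ] := @linear_facts _ V H j (fun c u v => jZD c u v I I).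
have PG w : P_G eps pi eta j w = 0 by rewrite /P_G HG0 proj_set0.
have PR v : P_R eps pi eta j (j v) = j v.
  apply: proj_id; last by move: HG0; rewrite /H_G => ->.
  by apply: nondegenerate_H_R => //; rewrite eta_onto.
have DR : D_R eps pi eta j = range j.
  rewrite /D_R eta_onto; apply/seteqP; split=> w.
    by move=> [_ [v _ <-] <-]; rewrite PR; exists v.
  by move=> [v _ <-]; exists (j v); [exists v | rewrite PR].
split=> //; first exact: generating_functional0.
- by move=> a; rewrite add0r.
- exists (fun a w => eps a *: w); first by move=> a b; rewrite PG.
  have [_ [_ [epsV [epsZD [epsM [eps1 epsS]]]]]] := gaussian_star_rep H char_eps.
  rewrite D_G_eq0//; split=> //.
  + split; first by split=> // c u v -> ->; rewrite scaler0 addr0.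
    split; first by move=> a v ->; rewrite /= scaler0.
    split; first by move=> a c u v _ _; apply: epsV.
    split; first by move=> c a b v _; apply: epsZD.
    split; first by move=> a b v _; apply: epsM.
    split; first by move=> v _; apply: eps1.
    by move=> a u v _ _; apply: epsS.
  + split=> [a | c a b | a b]; rewrite /eta_G /= ?PG ?scaler0 ?addr0//.
  + by move=> c a b; rewrite mulr0 addr0.
  + by move=> a; rewrite conjC0.
  + by move=> a b; rewrite /eta_G !PG inner0r mulr0 mul0r subr0 addr0 oppr0.
(* j is injective, so the representation can be transported to its range. *)
pose piR (a : A) w := j (pi a (xget 0 [set v | j v = w])).
have piRj a v : piR a (j v) = j (pi a v).
  by congr (j (pi a _)); apply: xget_unique => // u; apply: inj_j.
have [_ [_ [piZ [piD [piM [pi1 piS]]]]]] := pi_rep.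
exists piR.
  move=> a b; rewrite PR piRj -jZ -jD; congr j.
  by rewrite subrK.
rewrite DR; split=> //.
- split.
    by split=> [|c _ _ [u _ <-] [v _ <-]];
      [exists 0 | exists (c *: u + v); rewrite ?jD ?jZ].
  split; first by move=> a _ [v _ <-]; rewrite piRj; exists (pi a v).
  split; first by move=> a c _ _ [u _ <-] [v _ <-]; rewrite -jZ -jD !piRj piZ// jD jZ.
  split; first by move=> c a b _ [v _ <-]; rewrite !piRj piD// jD jZ.
  split; first by move=> a b _ [v _ <-]; rewrite !piRj piM.
  split; first by move=> _ [v _ <-]; rewrite piRj pi1.
  by move=> a _ _ [u _ <-] [v _ <-]; rewrite !piRj !jI// piS.
- split=> [a | c a b | a b]; rewrite /eta_R !PR; first by exists (eta a).
    by rewrite etaZD jD jZ.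
  by rewrite piRj etaM jD jZ.
- by move=> a b; rewrite /eta_R !PR jI.
Qed.

End PurelyNonGaussian.

Section NotNC.
Variables (R : realType) (K : nuStarAlg R[i]) (chi f : K -> R[i]) (e q : K).
Local Notation "k ** l" := (nu_mul k l) (at level 40).

(** The cocycle f for the one-dimensional representation a |-> a.1 + chi a.2 has
    H_G = 0, because e acts as 1; completing it would give
    psi (star q ** q) = <f q, f q> = 1, but star q ** q = 0. *)
Lemma not_NC : scalar chi -> (forall k l, chi (k ** l) = chi k * chi l) ->
  (forall k, chi (nu_star k) = (chi k)^*) -> chi e = 1 ->
  scalar f -> (forall k l, f (k ** l) = chi k * f l) ->
  nu_star q ** q = 0 -> f q = 1 -> ~ has_NC (@aug _ K).
Proof.
move=> chiZD chiM chiS chie fZD fM qq fq nc.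
have [chi0 chiD chiZ] := @linear_facts _ K R[i]^o chi chiZD.
have [f0 fD fZ] := @linear_facts _ K R[i]^o f fZD.
pose V := scalars R[i].
pose pi (a : unitization K) (v : V) : V := (a.1 + chi a.2) *: v.
pose eta (a : unitization K) : V := f a.2.
have pi_rep : star_rep [set: V] pi.
  do !split=> //; rewrite /pi.
  - by move=> a c u v _ _; rewrite scalerDr !scalerA mulrC.
  - move=> c a b v _; rewrite scalerA -scalerDl; congr (_ *: _).
    by rewrite /= chiD chiZ /GRing.scale /=; ring.
  - move=> a b v _; rewrite scalerA; congr (_ *: _).
    by rewrite /= !chiD !chiZ chiM /GRing.scale /=; ring.
  - by move=> v _; rewrite /= chi0 addr0 scale1r.
  - by move=> a u v _ _; rewrite innerZl innerZr /= chiS rmorphD.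
have eta_coc : cocycle (@aug _ K) [set: V] pi eta.
  split=> // [c a b | a b]; first exact: fZD.
  by rewrite /eta /pi /= !fD !fZ fM /aug /GRing.scale /=; ring.
have eta_onto : range eta = [set: V].
  apply/seteqP; split=> // v _; exists (incl (v *: q)) => //.
  by rewrite /eta /= fZ fq [LHS]mulr1.
have id_compl : is_completion (range eta) (id : V -> V).
  by rewrite eta_onto; apply: scalars_completion.
have [|psi psi_triple] := nc V pi eta pi_rep eta_coc V id id_compl.
  apply/D_G_eq0/(nondegenerate_H_G id_compl) => v _; exists (incl e) => //.
  by rewrite /pi /= chie add0r scale1r.
have := schurmann_incl psi_triple (nu_star q) q; rewrite qq nu_starK incl0.
case: psi_triple => _ _ psiZD _ _.
have [-> _ _] := @linear_facts _ (unitization K) R[i]^o psi psiZD.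
rewrite /eta /= fq /inner /= /scalar_dot conjC1 mulr1 => /esym/eqP.
by rewrite oner_eq0.
Qed.

End NotNC.

(** * The four ideals *)

Section Examples.
Variable C : numClosedFieldType.

Fact conj_starP (c : C) (k l : C^o) : (c *: k + l)^* = c^* *: (k^* : C^o) + l^*.
Proof. by rewrite /GRing.scale /= [LHS](rmorphD (@Num.conj C)) rmorphM. Qed.

Local Obligation Tactic := idtac.

(** The ideal C x of the dual numbers, with x^2 = 0. *)
Program Definition dual_ideal : nuStarAlg C :=
  @NuStarAlg C C^o (fun _ _ => 0) (fun k => k^*) _ _ _ _ _ _.
Next Obligation. by []. Qed.
Next Obligation. by move=> l c k k'; rewrite scaler0 addr0. Qed.
Next Obligation. by move=> l c k k'; rewrite scaler0 addr0. Qed.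
Next Obligation. by move=> k; apply: conjCK. Qed.
Next Obligation. by move=> c k l; apply: conj_starP. Qed.
Next Obligation. by move=> k l; rewrite /= conjC0. Qed.

(** The ideal x C[x] / (x^3); (a, b) stands for a x + b x^2. *)
Program Definition cubic_ideal : nuStarAlg C :=
  @NuStarAlg C (C^o * C^o)%type (fun k l => (0, k.1 * l.1))
    (fun k => (k.1^*, k.2^*)) _ _ _ _ _ _.
Next Obligation. by move=> k l m /=; rewrite mulr0 mul0r. Qed.
Next Obligation.
by move=> l c k k'; congr (_, _); rewrite /= /GRing.scale /=; ring.
Qed.
Next Obligation.
by move=> l c k k'; congr (_, _); rewrite /= /GRing.scale /=; ring.
Qed.
Next Obligation. by case=> x y; rewrite /= !conjCK. Qed.
Next Obligation. by move=> c k l; congr (_, _); apply: conj_starP. Qed.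
Next Obligation. by move=> k l; congr (_, _); rewrite /= ?conjC0// rmorphM mulrC. Qed.

(** The ideal spanned by e, p, q = star p with e e = e, p e = p, e q = q, all
    other products of these being 0; (a, b, c) stands for a e + b p + c q. *)
Program Definition corner_ideal : nuStarAlg C :=
  @NuStarAlg C (C^o * C^o * C^o)%type
    (fun k l => (k.1.1 * l.1.1, k.1.2 * l.1.1, k.1.1 * l.2))
    (fun k => (k.1.1^*, k.2^*, k.1.2^*)) _ _ _ _ _ _.
Next Obligation. by move=> k l m /=; rewrite !mulrA. Qed.
Next Obligation.
by move=> l c k k'; congr (_, _, _); rewrite /= /GRing.scale /=; ring.
Qed.
Next Obligation.
by move=> l c k k'; congr (_, _, _); rewrite /= /GRing.scale /=; ring.
Qed.
Next Obligation. by case=> [[x y] z]; rewrite /= !conjCK. Qed.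
Next Obligation. by move=> c k l; congr (_, _, _); apply: conj_starP. Qed.
Next Obligation. by move=> k l; congr (_, _, _); rewrite /= rmorphM mulrC. Qed.

Program Definition ideal_sum (K L : nuStarAlg C) : nuStarAlg C :=
  @NuStarAlg C (K * L)%type
    (fun k l => (nu_mul k.1 l.1, nu_mul k.2 l.2))
    (fun k => (nu_star k.1, nu_star k.2)) _ _ _ _ _ _.
Next Obligation. by move=> K L k l m; congr (_, _); apply: nu_mulA. Qed.
Next Obligation. by move=> K L l c k k'; congr (_, _); apply: nu_mulPl. Qed.
Next Obligation. by move=> K L l c k k'; congr (_, _); apply: nu_mulPr. Qed.
Next Obligation. by move=> K L [k l]; congr (_, _); apply: nu_starK. Qed.
Next Obligation. by move=> K L c k l; congr (_, _); apply: nu_starP. Qed.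
Next Obligation. by move=> K L k l; congr (_, _); apply: nu_starM. Qed.

End Examples.

(** * Their properties *)

Section Properties.
Variable R : realType.

(** The representation kills x, so H_G is the whole completion, and D_G = 0 forces
    eta = 0. *)
Lemma dual_NC : has_NC (@aug _ (dual_ideal R[i])).
Proof.
move=> V pi eta pi_rep eta_coc H j j_compl DG0.
have pi_eps a v : pi a v = aug a *: v.
  rewrite star_rep_incl// star_rep_nil ?addr0// => u.
  exact: (star_rep0 _ pi_rep).
have [_ etaZD _] := eta_coc; have [_ _ jI _] := j_compl.
have eta_eq0 a : eta a = 0.
  have eta_a : range eta (eta a) by exists a.
  apply: inner_eq0; rewrite -jI//.
  suff -> : j (eta a) = 0 by apply: inner0r.
  have : D_G (@aug _ _) pi eta j (j (eta a)).
    by rewrite D_G_top; [exists (eta a) | apply: H_G_top].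
  by rewrite DG0.
by apply: (completable_zero pi_rep eta_coc).
Qed.

Lemma dual_not_GC : ~ has_GC (@aug _ (dual_ideal R[i])).
Proof.
by apply: (@not_GC _ (dual_ideal R[i]) id (1 : R[i])) => //; apply: conjC1.
Qed.

(** Every k in the ideal has star k * k proportional to x^2, and x^2 squares to 0;
    so pi vanishes on the ideal in two steps, and eta (x^2) = 0. *)
Lemma cubic_AC : has_AC (@aug _ (cubic_ideal R[i])).
Proof.
move=> V pi eta pi_rep eta_coc.
have pi0 := star_rep0 _ pi_rep.
have pi_sq (b : R[i]) v : pi (incl ((0, b) : cubic_ideal R[i])) v = 0.
  apply: star_rep_nil pi_rep _ _ => u.
  by rewrite /nu_mul /= mulr0; apply: pi0.
have pi_K k v : pi (incl k) v = 0.
  by apply: star_rep_nil pi_rep _ _ => u; apply: pi_sq.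
pose x : cubic_ideal R[i] := (1, 0).
have eta_sq (b : R[i]) : eta (incl ((0, b) : cubic_ideal R[i])) = 0.
  suff -> : (0, b) = nu_mul x (b, 0) :> cubic_ideal R[i].
    by rewrite (cocycle_inclM eta_coc) pi_K.
  by congr (_, _); rewrite /= mul1r.
have eta_K (k : cubic_ideal R[i]) : eta (incl k) = (k.1 : R[i]) *: eta (incl x).
  have [_ etaZD _] := eta_coc.
  have -> : incl k = (k.1 : R[i]) *: incl x + incl ((0, k.2) : cubic_ideal R[i]).
    case: k => a b; congr (_, (_, _)); rewrite /= ?scaler0 ?addr0 ?add0r//.
    by rewrite [RHS]mulr1.
  by rewrite etaZD eta_sq addr0.
pose r := inner (eta (incl x)) (eta (incl x)).
apply: (completable_incl pi_rep eta_coc (psi := fun k => (k.2 : R[i]) * r)).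
- by move=> c k l; rewrite mulrDl -mulrA.
- by move=> k; rewrite rmorphM /= inner_conj.
- by move=> k l; rewrite (eta_K (nu_star k)) (eta_K l) innerZl innerZr conjCK mulrA.
Qed.

(** The cocycle c separates (x, x^2) from 0 although x x^2 = 0. *)
Lemma cubic_not_H2Z : ~ has_H2Z (@aug _ (cubic_ideal R[i])).
Proof.
pose A := unitization (cubic_ideal R[i]).
pose c (a b : A) : R[i] := a.2.1 * b.2.2 + a.2.2 * b.2.1.
pose x : A := incl ((1, 0) : cubic_ideal R[i]).
pose y : A := incl ((0, 1) : cubic_ideal R[i]).
move=> /(_ c) [|f fZD /(_ x y)].
  split; [move=> b d a a' | move=> a d b b' | move=> a b d];
    by rewrite /c /aug /= /GRing.scale /=; ring.
have -> : x * y = 0 by congr (_, (_, _)); rewrite /= /GRing.scale /=; ring.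
have [-> _ _] := @linear_facts _ A R[i]^o f fZD.
rewrite /c /aug /= !mul0r mulr0 subr0 !addr0 mulr1 => /eqP.
by rewrite oner_eq0.
Qed.

(** A Gaussian cocycle kills products, and they span the ideal. *)
Lemma corner_GC : has_GC (@aug _ (corner_ideal R[i])).
Proof.
move=> V eta gauss.
have pi_rep := gaussian_star_rep V (aug_character (corner_ideal R[i])).
have eta_coc := gaussian_cocycle gauss.
have eta_mul (k l : corner_ideal R[i]) : eta (incl (nu_mul k l)) = 0.
  by rewrite (cocycle_inclM eta_coc) scale0r.
have eta_eq0 (k : corner_ideal R[i]) : eta (incl k) = 0.
  have [_ etaZD _] := eta_coc; have [_ etaD _] := linear_facts etaZD.
  pose e : corner_ideal R[i] := (1, 0, 0).
  pose q : corner_ideal R[i] := (0, 0, k.2).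
  have -> : incl k = incl (nu_mul k e) + incl (nu_mul e q).
    rewrite /q; case: k {q} => [[a b] c].
    by congr (_, (_, _, _)); rewrite /= ?addr0//; ring.
  by rewrite etaD !eta_mul addr0.
by apply: (completable_zero pi_rep eta_coc).
Qed.

Lemma corner_not_NC : ~ has_NC (@aug _ (corner_ideal R[i])).
Proof.
apply: (@not_NC _ (corner_ideal R[i]) (fun k => k.1.1) (fun k => k.2)
  (1, 0, 0) (0, 0, 1)) => //.
by congr (_, _, _); rewrite /= ?conjC0; ring.
Qed.

Local Notation dual_corner := (ideal_sum (dual_ideal R[i]) (corner_ideal R[i])).

Lemma dual_corner_not_GC : ~ has_GC (@aug _ dual_corner).
Proof.
apply: (@not_GC _ dual_corner (fun k => k.1) (1, 0)) => //.
  by congr (_, (_, _, _)); rewrite /= ?conjC0 ?conjC1.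
by congr (_, (_, _, _)); rewrite /= mul0r.
Qed.

Lemma dual_corner_not_NC : ~ has_NC (@aug _ dual_corner).
Proof.
apply: (@not_NC _ dual_corner (fun k => k.2.1.1) (fun k => k.2.2)
  (0, (1, 0, 0)) (0, (0, 0, 1))) => //.
by congr (_, (_, _, _)); rewrite /= ?conjC0; ring.
Qed.

(** Positivity of psi gives eta k = 0 whenever star k * k = 0.  Every k differs
    from e k by such an element, so that eta k = pi e (eta k). *)
Lemma dual_corner_LK : has_LK (@aug _ dual_corner).
Proof.
move=> psi psi_gen V pi eta psi_triple eta_onto H j j_compl.
exists (fun=> 0), psi; apply: LK_of_nondegenerate => //; first exact: aug_character.
have [pi_rep eta_coc psiZD _ _] := psi_triple.
have [_ etaZD _] := eta_coc; have [_ etaD _] := linear_facts etaZD.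
have [psi0 _ _] := @linear_facts _ (unitization dual_corner) R[i]^o psi psiZD.
have eta_nil (k : dual_corner) : nu_mul (nu_star k) k = 0 -> eta (incl k) = 0.
  move=> kk; apply: inner_eq0; rewrite -{1}[k]nu_starK.
  by rewrite -(schurmann_incl psi_triple) kk incl0.
move=> v [a _ <-]; exists (incl ((0, (1, 0, 0)) : dual_corner)) => //.
rewrite (cocycle_incl pi_rep eta_coc a) -(cocycle_inclM eta_coc).
case: (a.2) => d [[e p] q].
(* n collects the x- and p-components, on which k and e k differ. *)
pose n : dual_corner := (d, (0, p, 0)).
have -> : incl ((d, (e, p, q)) : dual_corner)
        = incl (nu_mul ((0, (1, 0, 0)) : dual_corner) (d, (e, p, q))) + incl n.
  by congr (_, (_, (_, _, _))); rewrite /= ?addr0 ?add0r//; ring.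
rewrite etaD (eta_nil n) ?addr0//.
by congr (_, (_, _, _)); rewrite /= ?conjC0; ring.
Qed.

End Properties.

Theorem mainTheorem1 (R : realType) :
  (exists (A : starAlgType R[i]) (eps : A -> R[i]),
      [/\ character eps, has_AC eps & ~ has_H2Z eps])
  /\ (exists (A : starAlgType R[i]) (eps : A -> R[i]),
      [/\ character eps, has_NC eps & ~ has_AC eps])
  /\ (exists (A : starAlgType R[i]) (eps : A -> R[i]),
      [/\ character eps, has_GC eps & ~ has_AC eps])
  /\ (exists (A : starAlgType R[i]) (eps : A -> R[i]),
      [/\ character eps, has_GC eps & ~ has_NC eps])
  /\ (exists (A : starAlgType R[i]) (eps : A -> R[i]),
      [/\ character eps, has_NC eps & ~ has_GC eps])
  /\ (exists (A : starAlgType R[i]) (eps : A -> R[i]),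
      [/\ character eps, has_LK eps & ~ (has_GC eps \/ has_NC eps)]).
Proof.
have dualE := aug_character (dual_ideal R[i]).
have cornerE := aug_character (corner_ideal R[i]).
split; first by exists _, (@aug _ (cubic_ideal R[i])); split;
  [exact: aug_character | exact: cubic_AC | exact: cubic_not_H2Z].
split; first by exists _, (@aug _ (dual_ideal R[i])); split;
  [ | exact: dual_NC | move=> /(AC_GC dualE); exact: dual_not_GC].
split; first by exists _, (@aug _ (corner_ideal R[i])); split;
  [ | exact: corner_GC | move=> /AC_NC; exact: corner_not_NC].
split; first by exists _, (@aug _ (corner_ideal R[i])); split;
  [ | exact: corner_GC | exact: corner_not_NC].
split; first by exists _, (@aug _ (dual_ideal R[i])); split;
  [ | exact: dual_NC | exact: dual_not_GC].
exists _, (@aug _ (ideal_sum (dual_ideal R[i]) (corner_ideal R[i]))); split.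
- exact: aug_character.
- exact: dual_corner_LK.
- by case; [exact: dual_corner_not_GC | exact: dual_corner_not_NC].
Qed.
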